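(* Consider a budgeted causal bandit instance on a no-backdoor graph with $M\geq 2$ binary intervenable nodes, intervention cost $\gamma\ge 1$, $\mathbf{p}=(p_1,\dots,p_M)$, and $p=\min_{i,x}p_{i,x}>0$. Let $r(B)$ be the simple regret of the algorithm $\gamma$-NB-ALG (defined in the context) with budget $B$. (i) If $\gamma\ge\frac{1}{p\cdot m(\mathbf{p})}$, then $E[r(B)]=O\left(\sqrt{\frac{1}{pB}\log (pMB)}\right)$. (ii) If $\gamma\le\frac{1}{p\cdot m(\mathbf{p})}$, then $E[r(B)]=O\left(\sqrt{\frac{\gamma\cdot m(\mathbf{p})}{B}\log \frac{MB}{\gamma \cdot m(\mathbf{p})}}\right)$. Here $O(\cdot)$ means: there is a universal constant $C$ such that for every instance there is a finite $B_0$ (depending on the instance) such that $E[r(B)]$ is at most $C$ times the displayed expression for all $B\ge B_0$.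
   Context: Setting. A causal Bayesian network is a directed acyclic graph $\mathcal{G}$ whose nodes are random variables with finite ranges, together with a joint distribution $\mathbb{P}$ factorizing over $\mathcal{G}$. The intervention $do(X=x)$ removes all edges from the parents of $X$ into $X$ and sets $X=x$; the empty intervention $do()$ (observation) samples from $\mathbb{P}$. There is a reward node $Y\in\{0,1\}$ and a set of intervenable nodes $X_1,\dots,X_M\in\{0,1\}$; when not intervened upon, $X_i\sim\mathrm{Bernoulli}(p_i)$, with $p_{i,1}=p_i$, $p_{i,0}=1-p_i$. The graph is a no-backdoor graph: there are no backdoor paths from any $X_i$ to $Y$, so that $E[Y\mid do(X_i=x)]=E[Y\mid X_i=x]$. Arms. $\mathcal{A}=\{a_{i,x}: i\in[M],x\in\{0,1\}\}\cup\{a_0\}$, where $a_{i,x}=do(X_i=x)$ has mean reward $\mu_{i,x}=E[Y\mid X_i=x]$, and $a_0=do()$ has mean reward $\mu_0=E[Y]$. Pulling $a_0$ costs $1$ and reveals an independent sample of all variables (in particular $X_1,\dots,X_M,Y$); pulling $a_{i,x}$ costs $\gamma\ge 1$ and reveals an independent sample from the intervened distribution. The algorithm knows $\mathcal{G},B,\gamma$ but not $\mathbb{P}$. The quantity $m$. For a vector $\mathbf{q}=(q_1,\dots,q_M)\in[0,1]^M$ write $q_{i,1}=q_i$, $q_{i,0}=1-q_i$. For an integer $\tau\in\{2,\dots,M\}$ let $I_\tau(\mathbf q)=\{i\in[M]:\min_x q_{i,x}<\frac1\tau\}$, and $m(\mathbf{q})=\min\{\tau\in\{2,\dots,M\}: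 |I_\tau(\mathbf q)|\le\tau\}$. Algorithm $\gamma$-NB-ALG (numbers of rounds rounded to integers where necessary; empirical means over an empty set of rounds are set to $0$). 1. Play $a_0$ for the first $B/2$ rounds. Let $\widehat\mu_0$ be the average of $Y_t$ over these rounds, $\widehat\mu_{i,x}$ the average of $Y_t$ over those of these rounds in which $X_i=x$, $\widehat p_{i,x}=\frac2B\sum_{t=1}^{B/2}\mathbb{1}\{X_i=x \text{ in round }t\}$, $\widehat p=\min_{i,x}\widehat p_{i,x}$, and $\widehat{\mathbf p}=(\widehat p_{1,1},\dots,\widehat p_{M,1})$. 2. If $\widehat p\cdot m(\widehat{\mathbf p})\ge\frac1\gamma$: play $a_0$ for the remaining $B/2$ rounds and recompute $\widehat\mu_0$ and all $\widehat\mu_{i,x}$ in the same way from all $B$ rounds. 3. Otherwise: let $A=\{a_{i,x}:\widehat p_{i,x}<\frac1{m(\widehat{\mathbf p})}\}$, play each arm in $A$ for $\frac{B}{2\gamma|A|}$ rounds, and for each $a_{i,x}\in A$ replace $\widehat\mu_{i,x}$ by the average of the rewards in the rounds of this step in which $a_{i,x}$ was pulled (all other estimates remain those of step 1). 4. Output $a_B\in\arg\max_{a\in\mathcal{A}}\widehat\mu_a$. Simple regret: $r(B)=\max_{a\in\mathcal{A}}\mu_a-\mu_{a_B}$; the expectation is over all randomness. $\log$ is the natural logarithm. *)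

(* Defs.v *)
From HB Require Import structures.
From mathcomp Require Import all_boot all_order all_algebra.
From mathcomp Require Import reals exp.

Set Implicit Arguments.
Unset Strict Implicit.
Unset Printing Implicit Defensive.

Import Order.TTheory GRing.Theory Num.Theory.
Local Open Scope ring_scope.

(* The range of node v is {0, ..., range_size v - 1}; v is binary iff
   range_size v = 2. @kernel v w y is P(v = y | parents of v as in w); the
   joint distribution is the product of these (see law), i.e. it factorizes
   over the graph. *)
Record causal_bn (R : realType) := CausalBN {
  node : finType;
  edge : rel node;
  range_size : node -> nat;
  kernel : forall v : node,
    {dffun forall u : node, 'I_(range_size u)} -> 'I_(range_size v) -> R;
  edge_acyclic : forall u v, edge u v -> ~~ connect edge v u;
  range_size_gt0 : forall v, (0 < range_size v)%N;
  kernel_ge0 : forall v w y, 0 <= @kernel v w y;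
  kernel_sum1 : forall v w, \sum_y @kernel v w y = 1;
  kernel_parents : forall v (w w' : {dffun forall u : node, 'I_(range_size u)}),
    (forall u, edge u v -> w u = w' u) -> @kernel v w =1 @kernel v w'
}.

Notation assignment G := {dffun forall u : node G, 'I_(range_size u)}.

Section CausalGraph.
Variables (R : realType) (G : causal_bn R).

(* Some (u, x) is do(u = x): the kernel of u is replaced by the point mass
   at x, which no longer depends on the parents of u. None is do(). *)
Definition do_kernel (d : option (node G * nat)) (v : node G)
    (w : assignment G) (y : 'I_(range_size v)) : R :=
  if d is Some (u, x) then
    if v == u then (nat_of_ord y == x)%:R else kernel w y
  else kernel w y.

Definition law (d : option (node G * nat)) (w : assignment G) : R :=
  \prod_(v : node G) do_kernel d w (w v).

Definition adjacent (u v : node G) := edge u v || edge v u.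

(* x :: s is a path in the skeleton (arrow directions ignored, no repeated
   node) from x to y whose first arrow points into x. *)
Definition backdoor_path (x y : node G) (s : seq (node G)) : bool :=
  if s is z :: _ then
    [&& edge z x, path adjacent x s, uniq (x :: s) & last x s == y]
  else false.

Definition no_backdoor (x y : node G) : Prop :=
  forall s, ~~ backdoor_path x y s.

End CausalGraph.

(* None is the arm do(), Some (i, x) the arm do(X_i = x). *)
Definition arm (M : nat) : finType := option ('I_M * bool).

Section MinThreshold.
Variables (R : realType) (M : nat).
Implicit Type q : 'I_M -> R.

Definition I_tau q (tau : nat) : {set 'I_M} :=
  [set i | Num.min (q i) (1 - q i) < tau%:R^-1].

(* tau = M always satisfies the condition, so the default value M of the
   iterated minimum is itself one of the values minimized over (M >= 2). *)
Definition m_of q : nat :=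
  \big[minn/M]_(2 <= tau < M.+1 | (#|I_tau q tau| <= tau)%N) tau.

(* The default 1 is harmless for probabilities when M > 0. *)
Definition min_prob (f : 'I_M -> bool -> R) : R :=
  \big[Num.min/1]_(ix : 'I_M * bool) f ix.1 ix.2.

End MinThreshold.

Section Bandit.
Variables (R : realType) (G : causal_bn R) (M : nat).
Variables (X : 'I_M -> node G) (Y : node G).

Definition arm_law (a : arm M) : assignment G -> R :=
  law (if a is Some (i, x) then Some (X i, nat_of_bool x) else None).

Definition reward (w : assignment G) : R := (nat_of_ord (w Y))%:R.

Definition is_val (i : 'I_M) (x : bool) (w : assignment G) : bool :=
  nat_of_ord (w (X i)) == x.

(* For a = do(X_i = x) this is E[Y | do(X_i = x)], which equals E[Y | X_i = x]
   in a no-backdoor graph. *)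
Definition mu (a : arm M) : R := \sum_w arm_law a w * reward w.

Definition prob (i : 'I_M) (x : bool) : R :=
  \sum_(w | is_val i x w) law None w.

Definition simple_regret (a : arm M) : R :=
  \big[Num.max/mu None]_(b : arm M) mu b - mu a.

Definition history := seq (arm M * assignment G).

(* Expectation of f over the history produced by pulling the arms in l one
   after the other, each pull revealing a fresh sample from its law. *)
Fixpoint play (l : seq (arm M)) (f : history -> R) : R :=
  if l is a :: l' then
    \sum_w arm_law a w * play l' (fun h => f ((a, w) :: h))
  else f [::].

(* Since n / 0 = 0, averages over an empty set of rounds are 0. *)
Definition average (s : seq (assignment G)) : R :=
  (\sum_(w <- s) reward w) / (size s)%:R.

Definition obs_mu (s : seq (assignment G)) (a : arm M) : R :=
  if a is Some (i, x) then average [seq w <- s | is_val i x w] else average s.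

Definition obs_prob (s : seq (assignment G)) (i : 'I_M) (x : bool) : R :=
  (count (is_val i x) s)%:R / (size s)%:R.

Definition obs_m (s : seq (assignment G)) : nat :=
  m_of (fun i => obs_prob s i true).

Section Algorithm.
Variables (gamma : R) (B : nat).

(* In what follows h1 is the history of the first B/2 rounds and h2 that of
   the subsequent rounds. *)

Definition keep_observing (h1 : history) : bool :=
  gamma^-1 <= min_prob (obs_prob (unzip2 h1)) * (obs_m (unzip2 h1))%:R.

Definition rare_arms (h1 : history) : {set arm M} :=
  [set a : arm M | if a is Some (i, x) then
     obs_prob (unzip2 h1) i x < (obs_m (unzip2 h1))%:R^-1 else false].

Definition pulls_per_arm (h1 : history) : nat :=
  Num.truncn (B%:R / (2 * gamma * #|rare_arms h1|%:R)).

Definition first_phase : seq (arm M) := nseq B./2 None.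

Definition second_phase (h1 : history) : seq (arm M) :=
  if keep_observing h1 then nseq (B - B./2) None
  else flatten [seq nseq (pulls_per_arm h1) a | a <- enum (rare_arms h1)].

Definition mu_hat (h1 h2 : history) (a : arm M) : R :=
  if keep_observing h1 then obs_mu (unzip2 (h1 ++ h2)) a
  else if a \in rare_arms h1 then
    average (unzip2 [seq r <- h2 | r.1 == a])
  else obs_mu (unzip2 h1) a.

(* Ties in the argmax may be broken arbitrarily, even depending on the whole
   history. *)
Definition output_rule (out : history -> history -> arm M) : Prop :=
  forall h1 h2 b, mu_hat h1 h2 b <= mu_hat h1 h2 (out h1 h2).

Definition expected_regret (out : history -> history -> arm M) : R :=
  play first_phase (fun h1 =>
    play (second_phase h1) (fun h2 => simple_regret (out h1 h2))).

End Algorithm.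
End Bandit.

(* Main.v *)
Require Import Defs.
From mathcomp Require Import all_boot all_order all_algebra.
From mathcomp Require Import reals sequences exp.
From mathcomp Require Import ring lra zify.

(* Without backdoor paths, the component of the parents of X_i in the skeleton
   deprived of X_i does not contain Y; exchanging its coordinates between an
   observed and an intervened sample shows E[Y | do(X_i = x)] = E[Y | X_i = x].
   A Bernstein bound with T = 16 ln B then controls, off an event of
   probability O(M / B^2), every empirical quantity: the first phase locates
   p within a factor 2 and m within a factor 2, and an arm estimated from V
   expected rounds has error O(sqrt (T / V)).  If observation continues then
   V is at least of order p B and 1 / p <= 4 gamma m; if it stops then V is at least of order
   B / (gamma m) and gamma m <= 4 / p.  So, up to a constant, the regret is
   bounded by both displayed expressions on every instance.  As B_0 may depend
   on the instance, the failure probability is negligible and the logarithms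
   in the statement are comparable with ln B. *)

Import Order.TTheory GRing.Theory Num.Theory.
Local Open Scope ring_scope.

(** * Bayesian networks without backdoor paths *)

Definition upd {R : realType} {G : causal_bn R} (v : node G) (w : assignment G)
    (y : 'I_(range_size v)) : assignment G := finfun (dfwith w y).

Lemma updE {R : realType} {G : causal_bn R} (v : node G) (w : assignment G) y :
  upd v w y v = y.
Proof. by rewrite ffunE dfwith_in. Qed.

Lemma upd_out {R : realType} {G : causal_bn R} (v u : node G)
    (w : assignment G) y : u != v -> upd v w y u = w u.
Proof. by move=> uv; rewrite ffunE dfwith_out // eq_sym. Qed.

(** This is how one coordinate of a dependent product is summed out without decomposing the
    product. *)
Lemma sum_upd {R : realType} {G : causal_bn R} (v : node G)
    (g : assignment G -> R) :
  \sum_w \sum_y g (upd v w y) = (range_size v)%:R * \sum_w g w.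
Proof.
rewrite mulr_sumr.
have -> : \sum_w (range_size v)%:R * g w =
    \sum_(w : assignment G) \sum_(y < range_size v) g w.
  by apply: eq_bigr => w _; rewrite sumr_const card_ord mulr_natl.
rewrite !pair_big /=.
(* Swapping [y] with the coordinate [w v] is an involution of the pairs [(w, y)]. *)
pose phi (t : assignment G * 'I_(range_size v)) := (upd v t.1 t.2, t.1 v).
have phiK : involutive phi.
  case=> w y; rewrite /phi /= updE; congr (_, _); apply/ffunP => u.
  case: (eqVneq u v) => [->|uv]; first by rewrite updE.
  by rewrite !upd_out.
by rewrite [RHS](reindex_inj (inv_inj phiK)).
Qed.

Lemma edge_neq {R : realType} {G : causal_bn R} {u v : node G} :
  edge u v -> u != v.
Proof. by move=> /edge_acyclic; apply: contraNneq => ->; exact: connect0. Qed.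

Section KernelFamily.
Variables (R : realType) (G : causal_bn R).
Variable k : forall v : node G, assignment G -> 'I_(range_size v) -> R.
Hypothesis k_sum1 : forall v w, \sum_y k v w y = 1.
Hypothesis k_parents : forall (v : node G) (w w' : assignment G),
  (forall u, edge u v -> w u = w' u) -> k v w =1 k v w'.

(** A node of [A] with the fewest descendants works: an edge to some [u] in [A] would give [u]
    strictly fewer, since acyclicity keeps [v] out of the descendants of [u]. *)
Lemma ex_sink (A : {set node G}) : A != set0 ->
  exists2 v, v \in A & forall u, u \in A -> ~~ edge v u.
Proof.
case/set0Pn => v0 v0A.
have [v vA vmin] := arg_minnP (fun v => #|connect (@edge R G) v|) v0A.
exists v => // u uA; apply/negP => vu; have := vmin _ uA; rewrite leqNgt.
move/negP; apply; apply: proper_card; apply/properP; split.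
  apply/subsetP => x; apply: connect_trans; exact: connect1.
by exists v; [exact: connect0 | exact: edge_acyclic].
Qed.

(* Replacing the kernels by uniform laws one sink at a time preserves the sum. *)
Lemma sum_prod_kernel : \sum_(w : assignment G) \prod_v k v w (w v) = 1.
Proof.
have n_neq0 (v : node G) : (range_size v)%:R != 0 :> R.
  by rewrite pnatr_eq0 -lt0n range_size_gt0.
pose g (A : {set node G}) (w : assignment G) (v : node G) : R :=
  if v \in A then k v w (w v) else (range_size v)%:R^-1.
suff H (n : nat) (A : {set node G}) : #|A| = n -> \sum_w \prod_v g A w v = 1.
  rewrite -[RHS](H _ _ (erefl #|[set: node G]|)).
  by apply: eq_bigr => w _; apply: eq_bigr => v _; rewrite /g inE.
elim: n A => [|n IHn] A cardA.
  rewrite (eq_bigr (fun _ => \prod_(v : node G) (range_size v)%:R^-1)); last first.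
    by move=> w _; apply: eq_bigr => v _; rewrite /g (cards0_eq cardA) inE.
  rewrite sumr_const card_dep_ffun.
  have -> : foldr muln 1 [seq #|{: 'I_(range_size x)}| | x : node G] =
      (\prod_(v : node G) range_size v)%N.
    rewrite foldrE big_image /=.
    by apply: eq_bigr => v _; rewrite card_ord.
  rewrite -mulr_natl natr_prod -big_split /=; apply: big1 => v _.
  by rewrite mulfV.
have [|v vA sink] := @ex_sink A; first by rewrite -card_gt0 cardA.
have cardA' : #|A :\ v| = n by move: cardA; rewrite (cardsD1 v) vA => -[].
rewrite -[RHS](IHn _ cardA') -[LHS](mulKf (n_neq0 v)) -sum_upd mulr_sumr.
apply: eq_bigr => w _; rewrite [RHS](bigD1 v) //= {2}/g !inE eqxx /=.
congr (_ * _).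
(* As [v] is a sink of [A], changing its coordinate affects no other kernel still present, so only
   the factor of [v] depends on [y]. *)
rewrite (eq_bigr (fun y => k v w y * \prod_(u | u != v) g (A :\ v) w u)).
  by rewrite -mulr_suml k_sum1 mul1r.
move=> y _; rewrite (bigD1 v) //= {1}/g vA updE; congr (_ * _).
  apply: k_parents => u uv; rewrite upd_out //.
  exact: edge_neq uv.
apply: eq_bigr => u uv; rewrite /g !inE uv /=; case: ifP => // uA.
rewrite upd_out //; apply: k_parents => x xu; rewrite upd_out //.
by apply: contraTneq xu => ->; exact: sink.
Qed.

End KernelFamily.

Section Law.
Variables (R : realType) (G : causal_bn R).

Definition valid_do (d : option (node G * nat)) : bool :=
  if d is Some (u, x) then (x < range_size u)%N else true.

Lemma do_kernel_parents d (v : node G) (w w' : assignment G) :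
  (forall u, edge u v -> w u = w' u) -> do_kernel d w =1 @do_kernel R G d v w'.
Proof.
move=> ww' y; rewrite /do_kernel; case: d => [[u x]|]; last exact: kernel_parents.
by case: ifP => // _; exact: kernel_parents.
Qed.

Lemma do_kernel_ge0 d (v : node G) (w : assignment G) y :
  0 <= @do_kernel R G d v w y.
Proof.
rewrite /do_kernel; case: d => [[u x]|]; last exact: kernel_ge0.
by case: ifP => _; rewrite ?ler0n ?kernel_ge0.
Qed.

Lemma law_ge0 d (w : assignment G) : 0 <= law d w.
Proof. by apply: prodr_ge0 => v _; exact: do_kernel_ge0. Qed.

Lemma law_sum1 d : valid_do d -> \sum_(w : assignment G) law d w = 1.
Proof.
move=> dv; apply: (@sum_prod_kernel R G (fun v w y => do_kernel d w y)).
  move=> v w; rewrite /do_kernel; case: d dv => [[u x]|] dv; last exact: kernel_sum1.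
  case: eqVneq => [->|_]; last exact: kernel_sum1.
  rewrite (bigD1 (Ordinal dv)) //= eqxx big1 ?addr0 // => y /eqP yx.
  by case: eqP => // E; case: yx; apply: val_inj.
by move=> v w w' ww'; exact: do_kernel_parents.
Qed.

Lemma law_do_eq0 (u : node G) x (w : assignment G) :
  nat_of_ord (w u) != x -> law (Some (u, x)) w = 0.
Proof.
by move=> /negPf wx; rewrite /law (bigD1 u) //= /do_kernel eqxx wx mul0r.
Qed.

End Law.

(** * Exchange argument for graphs without backdoor paths *)

Section Backdoor.
Variables (R : realType) (G : causal_bn R) (x y : node G).
Hypothesis nbd : no_backdoor x y.

(** Only the target of a step must differ from [x]: walks start at parents of [x], which differ from
    [x], so they never meet it. *)
Let e : rel (node G) := [rel u v | Defs.adjacent u v && (v != x)].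
Let S : {set node G} := [set v | [exists z, edge z x && connect e z v]].

Let S_parent z : edge z x -> z \in S.
Proof. by move=> zx; rewrite inE; apply/existsP; exists z; rewrite zx connect0. Qed.

Let S_adj u v : u \in S -> Defs.adjacent u v -> v != x -> v \in S.
Proof.
rewrite !inE => /existsP[z /andP[zx zu]] uv vx; apply/existsP; exists z.
by rewrite zx (connect_trans zu) // connect1 // /e /= uv.
Qed.

Let path_avoid z s : z != x -> path e z s -> x \notin z :: s.
Proof.
elim: s z => [|u s IHs] z zx /=; first by rewrite inE eq_sym.
case/andP=> /andP[_ ux] /(IHs _ ux); rewrite !inE !negb_or eq_sym => /andP[-> ->].
by rewrite eq_sym zx.
Qed.

Let S_x : x \notin S.
Proof.
rewrite inE; apply/existsP => -[z /andP[zx /connectP[s zs xs]]].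
by have := path_avoid _ _ (edge_neq zx) zs; rewrite {1}xs mem_last.
Qed.

(** A walk avoiding [x] from a parent of [x] to [y] shortens to a simple path, which becomes a
    backdoor path once [x] is put in front. *)
Let S_y : y \notin S.
Proof.
rewrite inE; apply/existsP => -[z /andP[zx /connectP[s zs yl]]].
move: yl; have [s' zs' us' _ yl] := shortenP zs.
have := nbd (z :: s'); rewrite /backdoor_path zx /= -yl eqxx.
rewrite (path_avoid _ _ (edge_neq zx) zs') /Defs.adjacent zx orbT.
move: us'; rewrite /= => ->; rewrite !andbT /= => /negP; apply.
by apply: sub_path zs' => u v /andP[].
Qed.

Let mix (w w' : assignment G) : assignment G :=
  [ffun v => if v \in S then w v else w' v].

(** The factors match node by node. The parents of a node other than [x] are either [x], where the
    samples agree, or on the same side of [S] as the node, so its two factors are kept or swapped.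
    At [x] the observed kernel reads only parents, all in [S], and the intervened factor is 1. *)
Let law_mix (k : nat) (w w' : assignment G) :
  nat_of_ord (w x) = k -> nat_of_ord (w' x) = k ->
  law None w * law (Some (x, k)) w' =
  law None (mix w w') * law (Some (x, k)) (mix w' w).
Proof.
move=> wx w'x; rewrite /law -!big_split /=; apply: eq_bigr => v _; rewrite /do_kernel.
have wxE : w x = w' x by apply: val_inj; rewrite /= wx w'x.
have mixx (a b : assignment G) : a x = w x -> b x = w x -> mix a b x = w x.
  by move=> ax bx; rewrite ffunE; case: ifP.
have [->|vx] := eqVneq v x.
  rewrite /= !mixx // wx w'x eqxx !mulr1.
  by apply: kernel_parents => u ux; rewrite ffunE S_parent.
have [vS|vS] := boolP (v \in S).
  have par (a b : assignment G) u : a x = w x -> b x = w x -> edge u v -> mix a b u = a u.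
    move=> ax bx uv; have [->|ux] := eqVneq u x; first by rewrite mixx.
    by rewrite ffunE (S_adj _ _ vS) // /Defs.adjacent uv orbT.
  rewrite ![mix _ _ v]ffunE vS.
  by congr (_ * _); apply: kernel_parents => u uv; rewrite par.
have par (a b : assignment G) u : a x = w x -> b x = w x -> edge u v -> mix a b u = b u.
  move=> ax bx uv; have [->|ux] := eqVneq u x; first by rewrite mixx.
  rewrite ffunE ifN //; apply: contra vS => uS.
  by rewrite (S_adj _ _ uS) // /Defs.adjacent uv.
rewrite ![mix _ _ v]ffunE (negPf vS) mulrC.
by congr (_ * _); apply: kernel_parents => u uv; rewrite par.
Qed.

Lemma no_backdoor_factor (k : nat) (f : 'I_(range_size y) -> R) :
  (k < range_size x)%N ->
  \sum_(w : assignment G | nat_of_ord (w x) == k) law None w * f (w y) =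
  (\sum_(w : assignment G | nat_of_ord (w x) == k) law None w) *
  (\sum_(w : assignment G) law (Some (x, k)) w * f (w y)).
Proof.
move=> kx.
have restrict (h : assignment G -> R) :
    \sum_w law (Some (x, k)) w * h w =
    \sum_(w : assignment G | nat_of_ord (w x) == k) law (Some (x, k)) w * h w.
  rewrite [LHS](bigID (fun w : assignment G => nat_of_ord (w x) == k)) /=.
  rewrite [X in _ + X]big1 ?addr0 // => w wk.
  by rewrite law_do_eq0 ?mul0r.
have tot : \sum_(w : assignment G | nat_of_ord (w x) == k)
    law (Some (x, k)) w = 1.
  rewrite -(@law_sum1 R G (Some (x, k)) kx).
  under [RHS]eq_bigr do rewrite -[law _ _]mulr1.
  by rewrite restrict; apply: eq_bigr => w _; rewrite mulr1.
(* Both sides become double sums over an observed and an intervened sample. Exchanging the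
   coordinates in [S] is an involution, and as [y] is outside [S] it moves [f] from one sample to
   the other. *)
rewrite restrict -[LHS]mulr1 -[X in _ * X]tot !big_distrlr /= !pair_big /=.
pose phi (t : assignment G * assignment G) := (mix t.1 t.2, mix t.2 t.1).
have phiK : involutive phi.
  by case=> w w'; rewrite /phi /=; congr (_, _); apply/ffunP => u;
     rewrite !ffunE; case: (u \in S).
rewrite [RHS](reindex_inj (inv_inj phiK)) /=; apply: eq_big => [[w w']|[w w']] /=.
  by rewrite !ffunE (negPf S_x) andbC.
case/andP=> /eqP wk /eqP w'k.
by rewrite [mix w' w y]ffunE (negPf S_y) [RHS]mulrA -law_mix // mulrAC.
Qed.

End Backdoor.

(** * Concentration along a history *)

(** Inverting [1 - x <= expR (- x)] leaves [0 <= x ^+ 2 * (1 - 2 * x)], which holds for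
    [x <= 1 / 2]. *)
Lemma expR_le_quad {R : realType} (x : R) : `|x| <= 2^-1 ->
  expR x <= 1 + x + 2 * x ^+ 2.
Proof.
rewrite ler_norml => /andP[xl xu].
have x1 : 0 < 1 - x by lra.
have : expR x <= (1 - x)^-1.
  rewrite -[leLHS]invrK lef_pV2 ?posrE ?invr_gt0 ?expR_gt0 // -expRN.
  exact: expR_ge1Dx.
move=> /le_trans; apply.
rewrite -[leLHS]mul1r ler_pdivrMr // -subr_ge0.
have -> : (1 + x + 2 * x ^+ 2) * (1 - x) - 1 = x ^+ 2 * (1 - 2 * x) by ring.
by rewrite mulr_ge0 ?sqr_ge0 //; lra.
Qed.

Section Play.
Variables (R : realType) (G : causal_bn R) (M : nat).
Variables (X : 'I_M -> node G).
Hypothesis lawX_ge0 : forall a (w : assignment G), 0 <= arm_law X a w.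
Hypothesis lawX_sum1 : forall a, \sum_(w : assignment G) arm_law X a w = 1.

Local Notation hist := (history G M).

Lemma le_play (l : seq (arm M)) (f g : hist -> R) :
  (forall h, unzip1 h = l -> f h <= g h) -> play X l f <= play X l g.
Proof.
elim: l f g => [|a l IHl] f g fg /=; first exact: fg.
apply: ler_sum => w _; rewrite ler_wpM2l //; apply: IHl => h hl.
by apply: fg; rewrite /= hl.
Qed.

Lemma playD (l : seq (arm M)) (f g : hist -> R) :
  play X l (fun h => f h + g h) = play X l f + play X l g.
Proof.
elim: l f g => [|a l IHl] f g //=.
by rewrite -big_split /=; apply: eq_bigr => w _; rewrite IHl mulrDr.
Qed.

Lemma play_cst (l : seq (arm M)) (c : R) : play X l (fun=> c) = c.
Proof.
elim: l => [|a l IHl] //=.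
by under eq_bigr do rewrite IHl; rewrite -mulr_suml lawX_sum1 mul1r.
Qed.

Lemma playZ (l : seq (arm M)) (c : R) (f : hist -> R) :
  play X l (fun h => c * f h) = c * play X l f.
Proof.
elim: l f => [|a l IHl] f //=.
by rewrite mulr_sumr; apply: eq_bigr => w _; rewrite IHl mulrCA.
Qed.

Lemma play_sum (I : finType) (l : seq (arm M)) (f : I -> hist -> R) :
  play X l (fun h => \sum_i f i h) = \sum_i play X l (f i).
Proof.
elim: l f => [|a l IHl] f //=.
by rewrite exchange_big /=; apply: eq_bigr => w _; rewrite IHl mulr_sumr.
Qed.

Lemma eq_play (l : seq (arm M)) (f g : hist -> R) :
  f =1 g -> play X l f = play X l g.
Proof.
move=> fg; elim: l f g fg => [|a l IHl] f g fg /=; first exact: fg.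
by apply: eq_bigr => w _; congr (_ * _); apply: IHl => h; exact: fg.
Qed.

Lemma play_ge0 (l : seq (arm M)) (f : hist -> R) :
  (forall h, 0 <= f h) -> 0 <= play X l f.
Proof. by move=> f0; rewrite -(play_cst l 0); apply: le_play => h _. Qed.

Variables (v : arm M -> R).

(** Bernstein conditions for a single pull: the second moment bound [v] depends on the arm and may
    be far below the range bound 1. *)
Definition centered (F : arm M * assignment G -> R) (l : seq (arm M)) :=
  forall a, a \in l -> [/\ \sum_w arm_law X a w * F (a, w) = 0,
    (forall w, `|F (a, w)| <= 1)
    & \sum_w arm_law X a w * F (a, w) ^+ 2 <= v a].

(** The arms in [l] are fixed in advance, so the exponential moment factorizes over the pulls. By
    [expR_le_quad], the linear term vanishing, the factor of [a] is at most
    [1 + 2 * s ^+ 2 * v a]. *)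
Lemma play_expR_le (l : seq (arm M)) (F : arm M * assignment G -> R) (s : R) :
  centered F l -> 0 <= s <= 2^-1 ->
  play X l (fun h => expR (s * \sum_(r <- h) F r))
    <= expR (2 * s ^+ 2 * \sum_(a <- l) v a).
Proof.
move=> Fl /andP[s0 s1]; elim: l Fl => [|a l IHl] Fl /=.
  by rewrite !big_nil !mulr0 lexx.
have {}IHl := IHl (fun b bl => Fl b (mem_behead (s := a :: l) bl)).
have [F0 F1 F2] := Fl a (mem_head _ _).
set E := play X l _ in IHl.
have -> : \sum_w arm_law X a w * play X l
      (fun h => expR (s * \sum_(r <- (a, w) :: h) F r)) =
    (\sum_w arm_law X a w * expR (s * F (a, w))) * E.
  rewrite mulr_suml; apply: eq_bigr => w _; rewrite -mulrA; congr (_ * _).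
  by rewrite -playZ; apply: eq_play => h; rewrite big_cons mulrDr expRD.
rewrite big_cons mulrDr expRD; apply: ler_pM => //.
- by apply: sumr_ge0 => w _; rewrite mulr_ge0 ?expR_ge0.
- by apply: play_ge0 => h; exact: expR_ge0.
apply: le_trans (expR_ge1Dx _).
apply: (@le_trans _ _ (\sum_w (arm_law X a w + s * (arm_law X a w * F (a, w))
    + 2 * s ^+ 2 * (arm_law X a w * F (a, w) ^+ 2)))).
  apply: ler_sum => w _.
  rewrite (_ : _ + _ + _ = arm_law X a w *
    (1 + s * F (a, w) + 2 * (s * F (a, w)) ^+ 2)); last by ring.
  apply: ler_wpM2l => //; apply: expR_le_quad.
  by rewrite normrM ger0_norm // -[leRHS]mulr1 ler_pM.
rewrite !big_split /= -!mulr_sumr lawX_sum1 F0 mulr0 addr0 lerD2l.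
by rewrite ler_wpM2l // mulr_ge0 // sqr_ge0.
Qed.

Lemma play_tail (l : seq (arm M)) (F : arm M * assignment G -> R) (T : R) :
  centered F l -> 0 <= T <= 4 * \sum_(a <- l) v a ->
  0 < \sum_(a <- l) v a ->
  play X l (fun h =>
      (Num.sqrt ((\sum_(a <- l) v a) * T) < \sum_(r <- h) F r)%R%:R)
    <= expR (- (T / 8)).
Proof.
set V := \sum_(a <- l) v a => Fl /andP[T0 TV] V0.
(* Chernoff parameter: at the threshold [sqrt (V T)] the exponent is
   [- T / 4 + 2 * (T / 16) = - T / 8], and [T <= 4 V] amounts to [s <= 1 / 2]. *)
pose s := Num.sqrt (T / V) / 4.
have TV0 : 0 <= T / V by rewrite divr_ge0 // ltW.
have s0 : 0 <= s by rewrite divr_ge0 ?sqrtr_ge0.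
have s1 : s <= 2^-1.
  rewrite /s ler_pdivrMr // (_ : 2^-1 * 4 = 2); last by field.
  rewrite -[leRHS](ger0_norm (_ : 0 <= (2 : R))) // -sqrtr_sqr ler_wsqrtr //.
  by rewrite ler_pdivrMr // (_ : 2 ^+ 2 = 4) //; ring.
have sV : s * Num.sqrt (V * T) = T / 4.
  rewrite /s mulrAC -sqrtrM // (_ : T / V * (V * T) = T ^+ 2); last first.
    by field; rewrite gt_eqF.
  by rewrite sqrtr_sqr ger0_norm.
have s2V : s ^+ 2 * V = T / 16.
  by rewrite /s expr_div_n sqr_sqrtr //; field; rewrite gt_eqF.
apply: (@le_trans _ _ (play X l (fun h =>
    expR (- (T / 4)) * expR (s * \sum_(r <- h) F r)))).
  apply: le_play => h _; case: ltP => [lt_sum|_]; last first.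
    by rewrite mulr_ge0 ?expR_ge0.
  rewrite -expRD -[leLHS]expR0 ler_expR -sV addrC subr_ge0.
  by rewrite ler_wpM2l // ltW.
rewrite playZ.
apply: le_trans (ler_wpM2l (expR_ge0 _) (play_expR_le _ _ s Fl _)) _.
  by rewrite s0 s1.
by rewrite -expRD ler_expR -/V -mulrA s2V; lra.
Qed.

Lemma play_tail_abs (l : seq (arm M)) (F : arm M * assignment G -> R) (T : R) :
  centered F l -> 0 <= T <= 4 * \sum_(a <- l) v a ->
  0 < \sum_(a <- l) v a ->
  play X l (fun h =>
      (Num.sqrt ((\sum_(a <- l) v a) * T) < `|\sum_(r <- h) F r|)%R%:R)
    <= 2 * expR (- (T / 8)).
Proof.
move=> Fl TV V0.
have FNl : centered (fun r => - F r) l.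
  move=> a /Fl[F0 F1 F2]; split=> [|w|]; last first.
  - by under eq_bigr do rewrite sqrrN.
  - by rewrite normrN.
  - by under eq_bigr do rewrite mulrN; rewrite sumrN F0 oppr0.
rewrite mulr_natl mulr2n.
apply: le_trans (lerD (play_tail _ _ _ Fl TV V0) (play_tail _ _ _ FNl TV V0)).
rewrite -playD; apply: le_play => h _; rewrite sumrN.
case: ltP => [|_]; last by rewrite addr_ge0 ?ler0n.
case: (ger0P (\sum_(r <- h) F r)) => _ ->; first by rewrite lerDl ler0n.
by rewrite lerDr ler0n.
Qed.

End Play.

(** * The quantity m, empirical means and deviations *)

Section MinThreshold.
Variables (R : realType) (M : nat).
Hypothesis M2 : (2 <= M)%N.
Implicit Types q : 'I_M -> R.

Lemma m_of_spec q :
  [/\ (2 <= m_of q)%N, (m_of q <= M)%N & (#|I_tau q (m_of q)| <= m_of q)%N].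
Proof.
pose P t := [/\ (2 <= t)%N, (t <= M)%N & (#|I_tau q t| <= t)%N].
rewrite /m_of big_nat_cond; apply: (big_ind P) => [|x y Px Py|t].
- by split=> //; rewrite (leq_trans (max_card _)) // card_ord.
- by rewrite /minn; case: ifP.
by case/andP=> /andP[t2 tM] ct; split.
Qed.

Lemma m_of_le q t : (2 <= t <= M)%N -> (#|I_tau q t| <= t)%N -> (m_of q <= t)%N.
Proof.
move=> tM ct; have : t \in index_iota 2 M.+1 by rewrite mem_index_iota ltnS.
rewrite /m_of; elim: index_iota => // u r IHr; rewrite inE big_cons.
case/predU1P => [<-|tr]; first by rewrite ct geq_minl.
by case: ifP => _; rewrite ?IHr // geq_min IHr ?orbT.
Qed.

(** Let [t = m_of q']. If [2 t <= M], the error is at most [1 / (2 t)], so a coordinate below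
    [1 / (2 t)] for [q] is below [1 / t] for [q'], and [I_tau q (2 t)] has at most [t] elements. If
    [M < 2 t], the bound [m_of q <= M] is enough. *)
Lemma m_of_stable q q' :
  (forall i, `|q i - q' i| <= (2 * M%:R)^-1) -> (m_of q <= 2 * m_of q')%N.
Proof.
move=> qq'; have [t2 tM ct] := m_of_spec q'; set t := m_of q' in t2 tM ct *.
have [Mt|tM2] := ltnP M (2 * t).
  by have [_ qM _] := m_of_spec q; rewrite (leq_trans qM) // ltnW.
apply: m_of_le; first by rewrite tM2; lia.
rewrite (@leq_trans t) ?leq_pmull // (leq_trans _ ct) // subset_leq_card //.
apply/subsetP => i; rewrite !inE => qi.
have t0 : (0 : R) < t%:R by rewrite ltr0n; lia.
have Mt : (2 * M%:R)^-1 <= (2 * t%:R)^-1 :> R.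
  by rewrite lef_pV2 ?posrE ?mulr_gt0 ?ltr0n ?ler_pM2l ?ler_nat //; lia.
have tE : t%:R^-1 = (2 * t%:R)^-1 + (2 * t%:R)^-1 :> R by field; rewrite gt_eqF.
rewrite natrM in qi; have := qq' i; rewrite ler_norml => /andP[].
rewrite tE; move: qi; rewrite !gt_min => /orP[] qi ql qu; apply/orP.
  by left; lra.
by right; lra.
Qed.

End MinThreshold.

Section MinProb.
Variables (R : realType) (M : nat).
Implicit Types f g : 'I_M -> bool -> R.

Lemma min_prob_le f i x : min_prob f <= f i x.
Proof. exact: (@bigmin_le_cond _ _ _ _ (i, x)). Qed.

Lemma min_prob_le1 f : min_prob f <= 1.
Proof. exact: bigmin_le_id. Qed.

Lemma min_prob_near f g (d : R) : 0 <= d -> (forall i x, f i x <= g i x + d) ->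
  min_prob f <= min_prob g + d.
Proof.
move=> d0 fg; rewrite -lerBlDr; apply/bigmin_geP; split.
  (* The default value 1 of the iterated minimum must satisfy the bound too; [0 <= d] serves
     here. *)
  by rewrite lerBlDr (le_trans (min_prob_le1 f)) // lerDl.
by case=> i x _ /=; rewrite lerBlDr (le_trans (min_prob_le f i x)).
Qed.

End MinProb.

Section Averages.
Variables (R : realType) (G : causal_bn R) (Y : node G).

(** The deviation is divided by a count of at least [V / 2], and
    [3 sqrt (V T) / (V / 2) = sqrt (36 T / V)]. The factor 3 leaves room for the deviations of two
    observation phases. *)
Lemma average_near (t : seq (assignment G)) (c V T : R) :
  0 < V -> V / 2 <= (size t)%:R -> 0 <= T ->
  `|\sum_(w <- t) (reward Y w - c)| <= 3 * Num.sqrt (V * T) ->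
  `|average Y t - c| <= Num.sqrt (36 * T / V).
Proof.
move=> V0 Vt T0 dev; have t0 : (0 : R) < (size t)%:R by apply: lt_le_trans Vt; lra.
have -> : average Y t - c = (\sum_(w <- t) (reward Y w - c)) / (size t)%:R.
  rewrite /average sumrB mulrBl big_const_seq count_predT iter_addr_0.
  by rewrite -[X in _ - X / _]mulr_natr mulfK ?gt_eqF.
have -> : 36 * T / V = (6 / V) ^+ 2 * (V * T) by field; rewrite gt_eqF.
rewrite sqrtrM ?sqr_ge0 // sqrtr_sqr [in leRHS]ger0_norm; last first.
  by rewrite divr_ge0 // ltW.
rewrite normf_div (ger0_norm (ltW t0)) ler_pdivrMr // (le_trans dev) //.
have -> : 3 * Num.sqrt (V * T) = 6 / V * Num.sqrt (V * T) * (V / 2).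
  by field; rewrite gt_eqF.
by rewrite ler_wpM2l // mulr_ge0 ?sqrtr_ge0 // divr_ge0 // ltW.
Qed.

End Averages.

(** * Centered statistics attached to the arms *)

Section Model.
Variables (R : realType) (G : causal_bn R) (M : nat).
Variables (X : 'I_M -> node G) (Y : node G).
Hypothesis range_Y : range_size Y = 2%N.
Hypothesis range_X : forall i, range_size (X i) = 2%N.
Hypothesis nbd : forall i, no_backdoor (X i) Y.

Lemma arm_law_ge0 a (w : assignment G) : 0 <= arm_law X a w.
Proof. exact: law_ge0. Qed.

Lemma arm_law_sum1 a : \sum_(w : assignment G) arm_law X a w = 1.
Proof. by apply: law_sum1; case: a => [[i []]|] //=; rewrite range_X. Qed.

Lemma reward_ge0 (w : assignment G) : 0 <= reward Y w.
Proof. exact: ler0n. Qed.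

Lemma reward_le1 (w : assignment G) : reward Y w <= 1.
Proof. by rewrite /reward lern1 -ltnS (leq_trans (ltn_ord _)) ?range_Y. Qed.

Lemma mu_ge0 a : 0 <= mu X Y a.
Proof. by apply: sumr_ge0 => w _; rewrite mulr_ge0 ?arm_law_ge0 ?reward_ge0. Qed.

Lemma mu_le1 a : mu X Y a <= 1.
Proof.
rewrite -(arm_law_sum1 a); apply: ler_sum => w _.
by rewrite -[leRHS]mulr1 ler_wpM2l ?arm_law_ge0 ?reward_le1.
Qed.

Lemma reward_mu_le1 a (w : assignment G) : `|reward Y w - mu X Y a| <= 1.
Proof.
rewrite ler_norml; have := mu_ge0 a; have := mu_le1 a.
by have := reward_ge0 w; have := reward_le1 w; lra.
Qed.

Lemma simple_regret_le (D : R) a : 0 <= D ->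
  (forall b, mu X Y b - mu X Y a <= D) -> simple_regret X Y a <= D.
Proof.
move=> D0 ba; rewrite /simple_regret lerBlDr; apply: bigmax_le => [|b _].
  by rewrite -lerBlDr.
by rewrite -lerBlDr.
Qed.

Lemma simple_regret_le1 a : simple_regret X Y a <= 1.
Proof.
apply: simple_regret_le => // b.
by have := mu_ge0 a; have := mu_le1 b; lra.
Qed.

(** Marks the observed rounds that estimate [a]; taking do() as always selected lets it be treated
    like the other arms. *)
Definition selected (a : arm M) (w : assignment G) : bool :=
  if a is Some (i, x) then is_val X i x w else true.

Definition select_prob (a : arm M) : R := \sum_(w | selected a w) law None w.

Lemma select_prob_le1 a : select_prob a <= 1.
Proof.
rewrite -(arm_law_sum1 None) [leRHS](bigID (selected a)) /= lerDl.
by apply: sumr_ge0 => w _; exact: law_ge0.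
Qed.

Lemma min_prob_le_select a : min_prob (prob X) <= select_prob a.
Proof.
case: a => [[i x]|]; first exact: min_prob_le.
by rewrite /select_prob /= (arm_law_sum1 None) min_prob_le1.
Qed.

(** The absence of backdoor paths enters the analysis here: rewards observed when [X i] equals [x]
    are unbiased for the intervened mean, so [dev] is centered. *)
Lemma select_mean a :
  \sum_(w | selected a w) law None w * reward Y w = select_prob a * mu X Y a.
Proof.
case: a => [[i x]|]; last by rewrite /select_prob /= (arm_law_sum1 None) mul1r.
apply: (@no_backdoor_factor R G (X i) Y (nbd i) x
  (fun y => (nat_of_ord y)%:R)).
by rewrite range_X; case: x.
Qed.

Lemma obs_muE (s : seq (assignment G)) a :
  obs_mu X Y s a = average Y [seq w <- s | selected a w].
Proof. by case: a => [[i x]|] //=; rewrite filter_predT. Qed.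

(* The second moment of [dev a] is at most [select_prob a]; this is what yields
   the rate 1 / sqrt p instead of 1 / p. *)
Definition dev (a : arm M) (r : arm M * assignment G) : R :=
  (selected a r.2)%:R * (reward Y r.2 - mu X Y a).

Definition count_dev (a : arm M) (r : arm M * assignment G) : R :=
  (selected a r.2)%:R - select_prob a.

Definition pull_dev (a : arm M) (r : arm M * assignment G) : R :=
  (r.1 == a)%:R * (reward Y r.2 - mu X Y a).

Lemma sum_selected a (f : assignment G -> R) :
  \sum_w law None w * ((selected a w)%:R * f w) =
  \sum_(w | selected a w) law None w * f w.
Proof.
rewrite [RHS]big_mkcond; apply: eq_bigr => w _.
by case: (selected a w); rewrite ?mul1r ?mul0r ?mulr0.
Qed.

Lemma sqr_le1 (x : R) : `|x| <= 1 -> x ^+ 2 <= 1.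
Proof. by move=> x1; rewrite -real_normK ?num_real // exprn_ile1. Qed.

Lemma centered_dev a n :
  centered R G M X (fun=> select_prob a) (dev a) (nseq n None).
Proof.
move=> b; rewrite mem_nseq => /andP[_ /eqP->]; split=> [|w|].
- rewrite sum_selected; under eq_bigr do rewrite mulrBr.
  by rewrite sumrB select_mean -mulr_suml subrr.
- rewrite /dev; case: (selected _ _); rewrite ?mul0r ?normr0 // mul1r.
  exact: reward_mu_le1.
rewrite (eq_bigr (fun w => law None w *
    ((selected a w)%:R * (reward Y w - mu X Y a) ^+ 2))); last first.
  by move=> w _; rewrite /dev; case: selected; rewrite ?mul1r ?mul0r ?expr0n.
rewrite sum_selected; apply: ler_sum => w _.
by rewrite -[leRHS]mulr1 ler_wpM2l ?law_ge0 ?sqr_le1 ?reward_mu_le1.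
Qed.

(** The crude second moment bound 1 suffices: frequencies are only needed up to an accuracy fixed by
    the instance, reached once the budget is large. *)
Lemma centered_count_dev a n :
  centered R G M X (fun=> 1) (count_dev a) (nseq n None).
Proof.
have q0 : 0 <= select_prob a by apply: sumr_ge0 => w _; exact: law_ge0.
have c1 r : `|count_dev a r| <= 1.
  rewrite ler_norml; have := select_prob_le1 a; move: q0; rewrite /count_dev.
  by case: (selected _ _) => /=; lra.
move=> b; rewrite mem_nseq => /andP[_ /eqP->]; split=> [|w //|].
- rewrite /count_dev /=; under eq_bigr do rewrite mulrBr.
  rewrite sumrB -mulr_suml (arm_law_sum1 None) mul1r.
  under eq_bigr do rewrite -[X in _ * X]mulr1.
  rewrite sum_selected; under eq_bigr do rewrite mulr1.
  exact: subrr.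
rewrite -[leRHS](arm_law_sum1 None); apply: ler_sum => w _.
by rewrite -[leRHS]mulr1 ler_wpM2l ?law_ge0 ?sqr_le1.
Qed.

(** Only pulls of [a] carry a second moment, so the tail bound involves the number of these pulls
    and not the length of [l]. *)
Lemma centered_pull_dev a l :
  centered R G M X (fun b => (b == a)%:R) (pull_dev a) l.
Proof.
move=> b _; rewrite /pull_dev /=; have [->|_] := eqVneq b a; split=> [|w|].
- under eq_bigr do rewrite mul1r mulrBr.
  by rewrite sumrB -mulr_suml arm_law_sum1 mul1r subrr.
- by rewrite mul1r reward_mu_le1.
- rewrite -[leRHS](arm_law_sum1 a); apply: ler_sum => w _.
  by rewrite -[leRHS]mulr1 ler_wpM2l ?arm_law_ge0 // mul1r sqr_le1 ?reward_mu_le1.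
- by rewrite big1 // => w _; rewrite mul0r mulr0.
- by rewrite mul0r normr0.
by rewrite big1 // => w _; rewrite mul0r expr0n mulr0.
Qed.

Lemma sum_count_dev a (h : history G M) :
  \sum_(r <- h) count_dev a r =
  (count (selected a) (unzip2 h))%:R - (size h)%:R * select_prob a.
Proof.
elim: h => [|r h IHh]; first by rewrite big_nil mul0r subr0.
rewrite big_cons IHh /= natrD -[(size h).+1]addn1 natrD /count_dev; ring.
Qed.

Lemma sum_dev a (h : history G M) :
  \sum_(r <- h) dev a r =
  \sum_(w <- unzip2 h | selected a w) (reward Y w - mu X Y a).
Proof.
rewrite [RHS]big_mkcond big_map; apply: eq_bigr => r _; rewrite /dev.
by case: selected; rewrite ?mul1r ?mul0r.
Qed.

Lemma sum_pull_dev a (h : history G M) :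
  \sum_(r <- h) pull_dev a r =
  \sum_(w <- unzip2 [seq r <- h | r.1 == a]) (reward Y w - mu X Y a).
Proof.
rewrite big_map big_filter [RHS]big_mkcond; apply: eq_bigr => r _.
by rewrite /pull_dev; case: eqP => _; rewrite ?mul1r ?mul0r.
Qed.

Lemma card_arm : #|arm M| = (2 * M).+1.
Proof. by rewrite card_option card_prod card_bool card_ord mulnC. Qed.

End Model.

(** * The algorithm on a fixed budget *)

Lemma half_bounds (k : nat) : (0 < k./2)%N ->
  (k./2 <= k - k./2)%N /\ (k - k./2 <= 4 * k./2)%N.
Proof. by have := odd_double_half k; case: odd; lia. Qed.

Section Regret.
Variables (R : realType) (G : causal_bn R) (M : nat).
Variables (X : 'I_M -> node G) (Y : node G) (gamma : R).
Hypothesis M2 : (2 <= M)%N.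
Hypothesis range_Y : range_size Y = 2%N.
Hypothesis range_X : forall i, range_size (X i) = 2%N.
Hypothesis nbd : forall i, no_backdoor (X i) Y.
Hypothesis gamma1 : 1 <= gamma.

Let p := min_prob (prob X).
Let m := m_of (fun i => prob X i true).
Hypothesis p0 : 0 < p.

Variables (B : nat) (out : history G M -> history G M -> arm M).
Hypothesis outP : output_rule X Y gamma out.
Let n := B./2.

Variables (T K : R).
(** Accuracy of the empirical frequencies: at most [p / 2], to locate [p] within a factor 2, and at
    most [1 / (4 M)], to apply [m_of_stable]. *)
Let delta := p / (4 * M%:R).
Hypothesis T1 : 1 <= T.
(** As [delta ^+ 2 <= p <= 1], this puts [T] below [p n] and below the number of pulls of any rare
    arm, as the tail bounds require. It also gives [sqrt (n T) <= n * delta] and, with [1 <= T],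
    [8 gamma m <= n]. *)
Hypothesis Tn : T <= delta ^+ 2 / (8 * gamma * M%:R) * n%:R.
(* Either choice works on every instance, see [keep_observingP] and
   [stop_observingP]. *)
Hypothesis KE : K = p^-1 \/ K = gamma * m%:R.

(** Here [1152 = 36 * 32]: the 36 is that of [average_near], and every estimate will rest on [V]
    expected rounds with [n <= 32 K V]. *)
Let eps := Num.sqrt (1152 * K * T / n%:R).

Let gamma0 : 0 < gamma. Proof. exact: lt_le_trans gamma1. Qed.

Let M0 : 0 < M%:R :> R. Proof. by rewrite ltr0n (leq_trans _ M2). Qed.

Let M2R : 2 <= M%:R :> R. Proof. by rewrite ler_nat. Qed.

Let m2R : 2 <= m%:R :> R.
Proof.
by rewrite ler_nat; have [m2 _ _] := m_of_spec _ _ M2 (fun i => prob X i true).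
Qed.

Let mM : m%:R <= M%:R :> R.
Proof.
by rewrite ler_nat; have [_ mM _] := m_of_spec _ _ M2 (fun i => prob X i true).
Qed.

Let p1 : p <= 1. Proof. exact: min_prob_le1. Qed.

Let delta0 : 0 < delta. Proof. by rewrite divr_gt0 // mulr_gt0. Qed.

Let delta_p : delta <= p / 2.
Proof.
rewrite ler_pM2l // lef_pV2 ?posrE ?mulr_gt0 //.
by have := M2R; lra.
Qed.

Let delta_M : delta <= (4 * M%:R)^-1.
Proof. by rewrite -[leRHS]mul1r ler_wpM2r // invr_ge0 mulr_ge0 // ltW. Qed.

Let delta2 : delta ^+ 2 <= p.
Proof.
have d0 := ltW delta0; rewrite expr2 -[leRHS]mulr1 ler_pM //.
  by rewrite (le_trans delta_p) //; have := p0; lra.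
by rewrite (le_trans delta_p) //; have := p1; lra.
Qed.

Let n0 : 0 < n%:R :> R.
Proof.
rewrite lt0r ler0n andbT; apply: contraTneq (T1) => n_0.
by rewrite -ltNge (le_lt_trans Tn) // n_0 mulr0.
Qed.

Let n_gt0 : (0 < n)%N. Proof. by rewrite -(ltr0n R). Qed.

Let Tn_m : T <= delta ^+ 2 * (n%:R / (8 * gamma * m%:R)).
Proof.
have m0 : 0 < m%:R :> R by have := m2R; lra.
apply: (le_trans Tn); rewrite mulrAC -mulrA; apply: ler_wpM2l; first exact: sqr_ge0.
apply: ler_wpM2l; first exact: ltW.
rewrite lef_pV2 ?posrE ?mulr_gt0 //.
by apply: ler_wpM2l => //; rewrite mulr_ge0 // ltW.
Qed.

Let gm8 : 8 <= 8 * gamma * m%:R.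
Proof. by have := m2R; have := gamma1; nra. Qed.

Let Tn_delta : T <= delta ^+ 2 * n%:R.
Proof.
apply: (le_trans Tn_m); rewrite ler_wpM2l ?sqr_ge0 // ler_pdivrMr.
  by rewrite ler_peMr ?ltW //; have := gm8; lra.
by have := gm8; lra.
Qed.

Let Tn_p : T <= p * n%:R.
Proof. by rewrite (le_trans Tn_delta) // ler_wpM2r // ltW. Qed.

Let n_gm : 8 * gamma * m%:R <= n%:R.
Proof.
have gm0 : 0 < 8 * gamma * m%:R by have := gm8; lra.
rewrite -[leLHS]mul1r -ler_pdivlMr //.
apply: (le_trans T1); apply: (le_trans Tn_m).
rewrite -[leRHS]mul1r; apply: ler_wpM2r; first by rewrite divr_ge0 // ltW.
exact: le_trans delta2 p1.
Qed.

Let T0 : 0 <= T. Proof. exact: le_trans T1. Qed.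

Let K1 : 1 <= K.
Proof.
case: KE => ->; first by rewrite invf_ge1.
by have := m2R; have := gamma1; nra.
Qed.

Let eps_le V : 0 < V -> n%:R <= 32 * K * V -> Num.sqrt (36 * T / V) <= eps.
Proof.
move=> V0 nV; rewrite ler_wsqrtr // ler_pdivrMr // mulrAC ler_pdivlMr //.
rewrite (_ : 1152 * K * T * V = 36 * T * (32 * K * V)); last by ring.
by rewrite ler_wpM2l // mulr_ge0.
Qed.

Let q := select_prob R G M X.

Let pq a : p <= q a.
Proof. exact: min_prob_le_select. Qed.

Let q0 a : 0 < q a. Proof. exact: lt_le_trans (pq a). Qed.

Definition bad_count (a : arm M) (h : history G M) : bool :=
  Num.sqrt (n%:R * T) < `|\sum_(r <- h) count_dev R G M X a r|.

Definition bad_dev (k : nat) (a : arm M) (h : history G M) : bool :=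
  Num.sqrt (k%:R * q a * T) < `|\sum_(r <- h) dev R G M X Y a r|.

Definition good (h1 : history G M) : bool :=
  [forall a, ~~ bad_count a h1 && ~~ bad_dev n a h1].

Lemma bad_dev_tail k a : (n <= k)%N ->
  play X (nseq k None) (fun h => (bad_dev k a h)%:R) <= 2 * expR (- (T / 8)).
Proof.
move=> nk; have k0 : 0 < k%:R :> R by rewrite ltr0n (leq_trans n_gt0).
have V : \sum_(b <- nseq k (None : arm M)) q a = k%:R * q a.
  by rewrite big_nseq iter_addr_0 mulr_natl.
have := play_tail_abs R G M X (arm_law_ge0 R G M X) (arm_law_sum1 R G M X range_X)
  _ _ _ T (centered_dev R G M X Y range_Y range_X nbd a k).
rewrite V; apply; last by rewrite mulr_gt0.
rewrite T0 (le_trans Tn_p) // mulrC (le_trans (_ : _ <= k%:R * q a)) //.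
  by rewrite ler_pM ?ler_nat // ltW.
have := ltW (mulr_gt0 k0 (q0 a)); lra.
Qed.

Lemma bad_count_tail a :
  play X (nseq n None) (fun h => (bad_count a h)%:R) <= 2 * expR (- (T / 8)).
Proof.
have V : \sum_(b <- nseq n (None : arm M)) 1 = n%:R :> R.
  by rewrite big_nseq iter_addr_0.
have := play_tail_abs R G M X (arm_law_ge0 R G M X) (arm_law_sum1 R G M X range_X)
  _ _ _ T (centered_count_dev R G M X range_X a n).
rewrite V; apply; last by [].
rewrite T0 (le_trans Tn_p) //; apply: ler_wpM2r; first exact: ltW.
by have := p1; lra.
Qed.

(** * Consequences of a good first phase *)

Section FirstPhase.
Variable h1 : history G M.
Hypothesis h1n : unzip1 h1 = nseq n None.
Hypothesis h1_good : good h1.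

Let s := unzip2 h1.
Let A := rare_arms X h1.
Let N := pulls_per_arm X gamma B h1.

Let size_h1 : size h1 = n.
Proof. by rewrite -(size_map fst) -/(unzip1 h1) h1n size_nseq. Qed.

Let size_s : size s = n. Proof. by rewrite size_map. Qed.

Lemma count_near a :
  `|(count (selected R G M X a) s)%:R - n%:R * q a| <= n%:R * delta.
Proof.
have /forallP/(_ a)/andP[+ _] := h1_good; rewrite /bad_count -leNgt.
rewrite sum_count_dev size_h1 => /le_trans; apply.
have nd0 : 0 <= n%:R * delta by rewrite mulr_ge0 // ltW.
rewrite -[leRHS]ger0_norm // -sqrtr_sqr ler_wsqrtr //.
rewrite exprMn expr2 -!mulrA ler_pM2l // mulrC (le_trans Tn_delta) //.
Qed.

Lemma dev_small a :
  `|\sum_(r <- h1) dev R G M X Y a r| <= Num.sqrt (n%:R * q a * T).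
Proof.
by have /forallP/(_ a)/andP[_] := h1_good; rewrite /bad_dev -leNgt.
Qed.

Lemma count_large a : n%:R * q a / 2 <= (count (selected R G M X a) s)%:R.
Proof.
have := count_near a; rewrite ler_norml => /andP[+ _].
rewrite lerBrDl => /(le_trans _); apply.
rewrite -mulrBr -mulrA ler_pM2l //.
by have := pq a; have := delta_p; lra.
Qed.

Lemma obs_prob_near i x : `|obs_prob X s i x - prob X i x| <= delta.
Proof.
rewrite /obs_prob size_s -(ler_pM2l n0).
apply: le_trans (count_near (Some (i, x))).
rewrite -{1}(ger0_norm (ltW n0)) -normrM mulrBr mulrCA divff ?mulr1 //.
by rewrite gt_eqF.
Qed.

Lemma obs_m_stable : (obs_m X s <= 2 * m)%N /\ (m <= 2 * obs_m X s)%N.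
Proof.
have dM : delta <= (2 * M%:R)^-1.
  rewrite (le_trans delta_M) // lef_pV2 ?posrE ?mulr_gt0 //.
  by have := M0; lra.
by split; apply: m_of_stable => // i; rewrite ?[X in `|X|]distrC;
   rewrite (le_trans _ dM) // ?obs_prob_near // distrC obs_prob_near.
Qed.

Lemma min_prob_obs :
  p / 2 <= min_prob (obs_prob X s) /\ min_prob (obs_prob X s) <= 2 * p.
Proof.
have near i x := obs_prob_near i x; split.
  have : p <= min_prob (obs_prob X s) + delta.
    apply: min_prob_near; first exact: ltW.
    by move=> i x; have := near i x; rewrite ler_norml => /andP[]; lra.
  by have := delta_p; lra.
have : min_prob (obs_prob X s) <= p + delta.
  apply: min_prob_near; first exact: ltW.
  by move=> i x; have := near i x; rewrite ler_norml => /andP[]; lra.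
by have := delta_p; have := p0; lra.
Qed.

(** For [K = gamma * m] the test yields [gamma^-1 <= (2 p) (2 m)], both empirical quantities being
    at most twice the true ones. For [K = p^-1] the product [K * p] is 1. *)
Lemma keep_observingP : keep_observing X gamma h1 -> 1 <= 4 * K * p.
Proof.
rewrite /keep_observing -/s => keep.
have [_ ph] := min_prob_obs; have [mh _] := obs_m_stable.
have mhR : (obs_m X s)%:R <= 2 * m%:R :> R by rewrite -natrM ler_nat.
case: KE => ->; first by rewrite mulfVK ?gt_eqF // ler1n.
have : gamma^-1 <= (2 * p) * (2 * m%:R).
  apply: le_trans keep _; apply: ler_pM => //.
  by have [+ _] := min_prob_obs; apply: le_trans; have := p0; lra.
by rewrite -[gamma^-1]mul1r ler_pdivrMr //; lra.
Qed.

(** For [K = p^-1] the failed test yields [(p / 2) (m / 2) < gamma^-1]; the other choice of [K] is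
    immediate. *)
Lemma stop_observingP : ~~ keep_observing X gamma h1 -> gamma * m%:R <= 4 * K.
Proof.
rewrite /keep_observing -/s -ltNge => stop.
have [ph _] := min_prob_obs; have [_ mh] := obs_m_stable.
have mhR : m%:R / 2 <= (obs_m X s)%:R :> R.
  by rewrite ler_pdivrMr // mulrC -natrM ler_nat.
case: KE => ->; last first.
  by have := gm8; lra.
rewrite ler_pdivlMr //.
have : (p / 2) * (m%:R / 2) < gamma^-1.
  apply: le_lt_trans stop; apply: ler_pM => //.
    by have := p0; lra.
  by have := m2R; lra.
by rewrite -[gamma^-1]mul1r ltr_pdivlMr //; lra.
Qed.

(** The index of a rare arm lies in the empirical [I_tau] at [obs_m], which has at most
    [obs_m <= 2 m] elements, and each index carries two arms. *)
Lemma rare_arms_le : (#|A| <= 4 * m)%N.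
Proof.
have [mh _] := obs_m_stable.
have [_ _ Imh] := m_of_spec _ _ M2 (fun i => obs_prob X s i true).
rewrite -/(obs_m X s) in Imh; set I := I_tau _ _ in Imh.
have sub : A \subset (fun t => Some t) @: setX I [set: bool].
  apply/subsetP => -[[i x]|]; rewrite !inE //= => rare.
  apply/imsetP; exists (i, x) => //; rewrite !inE andbT gt_min.
  case: x rare => [-> //|rare].
  (* The two empirical frequencies of a binary node add up to 1 because the sample is nonempty. *)
  suff <- : obs_prob X s i false = 1 - obs_prob X s i true by rewrite rare orbT.
  rewrite /obs_prob; apply/eqP; rewrite -subr_eq opprK -mulrDl -natrD addnC.
  have -> : count (is_val X i false) s = count (predC (is_val X i true)) s.
    apply: eq_count => w; rewrite /is_val /=.
    have : (w (X i) < 2)%N by rewrite -(range_X i).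
    by case: (nat_of_ord _) => [|[]].
  by rewrite count_predC divff // size_s gt_eqF.
rewrite (leq_trans (subset_leq_card sub)) // (leq_trans (leq_imset_card _ _)) //.
rewrite cardsX cardsT card_bool mulnC.
by rewrite (leq_trans (leq_mul (leqnn 2) (leq_trans Imh mh))) // mulnA.
Qed.

Lemma pulls_ge a : a \in A -> n%:R <= 8 * gamma * m%:R * N%:R.
Proof.
move=> aA; have A0 : 0 < #|A|%:R :> R by rewrite ltr0n; apply/card_gt0P; exists a.
have gm0 : 0 < gamma * m%:R by have := gm8; lra.
have le_x : n%:R / (4 * gamma * m%:R) <= B%:R / (2 * gamma * #|A|%:R).
  have A4 : #|A|%:R <= 4 * m%:R :> R by rewrite -natrM ler_nat rare_arms_le.
  have nB : 2 * n%:R <= B%:R :> R.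
    by rewrite -natrM ler_nat mul2n -[leqRHS]odd_double_half leq_addl.
  rewrite ler_pdivrMr; last by rewrite -mulrA mulr_gt0.
  rewrite mulrAC ler_pdivlMr ?mulr_gt0 //.
  apply: (@le_trans _ _ (n%:R * (2 * gamma * (4 * m%:R)))).
    by rewrite ler_pM2l // ler_pM2l // mulr_gt0.
  rewrite (_ : _ * _ = (2 * n%:R) * (4 * gamma * m%:R)); last by ring.
  by rewrite ler_wpM2r // -mulrA mulr_ge0 // ltW.
(* Truncation loses less than one pull; as [n / (4 gamma m) >= 2], at least half of this quantity
   remains. *)
have := truncnS_gt (B%:R / (2 * gamma * #|A|%:R)); rewrite -/N -addn1 natrD.
move/(le_lt_trans le_x); rewrite ltr_pdivrMr; last by rewrite -mulrA mulr_gt0.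
rewrite -/N /pulls_per_arm -/A.
have := n_gm; lra.
Qed.

(** After a stop, an arm outside [A] keeps its first estimate, already controlled by [good], so no
    failure is recorded for it. *)
Definition bad_estimate (a : arm M) (h2 : history G M) : bool :=
  if keep_observing X gamma h1 then bad_dev (B - n) a h2
  else (a \in A) &&
    (Num.sqrt (N%:R * T) < `|\sum_(r <- h2) pull_dev R G M X Y a r|).

Lemma sum_pulls a : ~~ keep_observing X gamma h1 -> a \in A ->
  \sum_(b <- second_phase X gamma B h1) (b == a)%:R = N%:R :> R.
Proof.
move=> stop aA; rewrite /second_phase ifN // big_flatten big_map big_enum /=.
rewrite (bigD1 a) //= big_nseq iter_addr_0 eqxx big1 ?addr0 // => b /andP[_ ba].
by rewrite big_nseq iter_addr_0 (negPf ba) mul0rn.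
Qed.

Let n_Bn : (n <= B - n)%N /\ (B - n <= 4 * n)%N.
Proof. exact: half_bounds n_gt0. Qed.

Let T_N a : a \in A -> 0 < N%:R :> R /\ T <= N%:R.
Proof.
move=> /pulls_ge nN; have gm0 : 0 < 8 * gamma * m%:R by have := gm8; lra.
suff TN : T <= N%:R by split=> //; exact: lt_le_trans (lt_le_trans ltr01 T1) TN.
apply: (le_trans Tn_m).
have nN' : n%:R / (8 * gamma * m%:R) <= N%:R by rewrite ler_pdivrMr // mulrC.
apply: le_trans nN'; rewrite ler_piMl //; first by rewrite divr_ge0 // ltW.
exact: le_trans delta2 p1.
Qed.

Lemma bad_estimate_tail a :
  play X (second_phase X gamma B h1) (fun h2 => (bad_estimate a h2)%:R)
    <= 2 * expR (- (T / 8)).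
Proof.
rewrite /bad_estimate; have [keep|stop] := boolP (keep_observing X gamma h1).
  rewrite /second_phase keep; apply: bad_dev_tail; exact: (proj1 n_Bn).
have [aA|_] /= := boolP (a \in A); last first.
  by rewrite play_cst ?mulr_ge0 ?expR_ge0 //; exact: arm_law_sum1.
have [N0 TN] := T_N _ aA.
have := play_tail_abs R G M X (arm_law_ge0 R G M X) (arm_law_sum1 R G M X range_X)
  _ _ _ T (centered_pull_dev R G M X Y range_Y range_X a (second_phase X gamma B h1)).
rewrite sum_pulls //; apply=> //.
by rewrite T0 (le_trans TN) //; lra.
Qed.

Lemma mu_hat_near a h2 : unzip1 h2 = second_phase X gamma B h1 ->
  ~~ bad_estimate a h2 -> `|mu_hat X Y gamma h1 h2 a - mu X Y a| <= eps.
Proof.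
move=> h2l; rewrite /bad_estimate /mu_hat -/A.
have V0 : 0 < n%:R * q a by rewrite mulr_gt0.
have obs_eps : 1 <= 32 * K * q a -> n%:R <= 32 * K * (n%:R * q a).
  by move=> Kq; rewrite mulrCA ler_peMr // ltW.
have [keep|stop] := boolP (keep_observing X gamma h1).
  (* Observation continues: [V = n * q a], and [1 <= 4 K p <= 4 K (q a)]. *)
  rewrite /bad_dev -leNgt obs_muE => dev2.
  apply: le_trans (eps_le _ V0 _); last first.
    apply: obs_eps; apply: (le_trans (keep_observingP keep)).
    have : 4 * K * p <= 4 * K * q a by rewrite ler_wpM2l //; have := K1; lra.
    have : 0 <= K * q a by rewrite mulr_ge0 ?ltW //; have := K1; lra.
    lra.
  apply: average_near => //.
    apply: (le_trans (count_large a)).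
    by rewrite size_filter /unzip2 map_cat count_cat ler_nat leq_addr.
  rewrite big_filter -sum_dev big_cat /=.
  apply: (le_trans (ler_normD _ _)).
  apply: le_trans (lerD (dev_small a) dev2) _.
  (* At most [4 n] rounds are added, so the second deviation is at most twice the bound on the
     first. *)
  rewrite (_ : 3 = 1 + 2); last by ring.
  rewrite mulrDl mul1r lerD2l.
  have -> : 2 * Num.sqrt (n%:R * q a * T) =
      Num.sqrt (2 ^+ 2 * (n%:R * q a * T)).
    by rewrite [RHS]sqrtrM ?sqr_ge0 // sqrtr_sqr ger0_norm.
  rewrite ler_wsqrtr // mulrA; apply: ler_wpM2r => //.
  rewrite mulrA; apply: ler_wpM2r; first exact: ltW.
  by rewrite (_ : 2 ^+ 2 = 4) -?natrM ?ler_nat; [exact: (proj2 n_Bn) | ring].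
case: ifP => [aA|/negbT aA] /=.
  (* A rare arm: [V] is its number of pulls, and [n <= 8 gamma m V <= 32 K V]. *)
  rewrite -leNgt => devA; have [N0 TN] := T_N _ aA.
  have sizeN : (size (unzip2 [seq r <- h2 | r.1 == a]))%:R = N%:R :> R.
    rewrite -(sum_pulls _ stop aA) -h2l big_map size_map size_filter.
    rewrite -sum1_count natr_sum big_mkcond /=.
    by apply: eq_bigr => r _; case: eqP.
  apply: le_trans (eps_le _ N0 _); last first.
    apply: (le_trans (pulls_ge _ aA)); apply: ler_wpM2r; first exact: ltW.
    by have := stop_observingP stop; lra.
  apply: average_near => //; first by rewrite sizeN; lra.
  rewrite -sum_pull_dev; apply: (le_trans devA).
  by have := sqrtr_ge0 (N%:R * T); lra.
(* An intervention that is not rare has [q a >= 1 / (2 m) - 1 / (4 m) = 1 / (4 m)], while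
   [m <= gamma m <= 4 K]. For do() the selection probability is 1. *)
move=> _; rewrite obs_muE -/s.
apply: le_trans (eps_le _ V0 _); last first.
  apply: obs_eps; case: a aA {V0} => [[i x]|] /=; last first.
    by rewrite /q /select_prob (arm_law_sum1 R G M X range_X None); have := K1; lra.
  rewrite inE -leNgt => rare.
  have m0 : 0 < m%:R :> R by have := m2R; lra.
  have Km : m%:R <= 4 * K.
    apply: le_trans (stop_observingP stop).
    by rewrite ler_peMl // ltW.
  have qm : (4 * m%:R)^-1 <= q (Some (i, x)).
    have [mh mh'] := obs_m_stable.
    have mh0 : 0 < (obs_m X s)%:R :> R.
      rewrite ltr0n lt0n; apply: contraTneq mh' => ->.
      by rewrite muln0 -ltnNge -(ltr0n R).
    have : (2 * m%:R)^-1 <= (obs_m X s)%:R^-1 :> R.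
      by rewrite lef_pV2 ?posrE ?mulr_gt0 // -natrM ler_nat.
    have dm : delta <= (4 * m%:R)^-1.
      apply: (le_trans delta_M); rewrite lef_pV2 ?posrE ?mulr_gt0 //.
      by rewrite ler_pM2l.
    have -> : (2 * m%:R)^-1 = (4 * m%:R)^-1 + (4 * m%:R)^-1 :> R.
      by field; rewrite gt_eqF.
    have := obs_prob_near i x; rewrite ler_norml => /andP[_].
    rewrite -/s in rare *; rewrite /q /select_prob /= -/(prob X i x).
    by move: rare dm; lra.
  apply: (@le_trans _ _ (32 * K * (4 * m%:R)^-1)).
    by rewrite ler_pdivlMr ?mulr_gt0 //; lra.
  by rewrite ler_wpM2l //; have := K1; lra.
apply: average_near => //; first by rewrite size_filter; exact: count_large.
rewrite big_filter -sum_dev; apply: (le_trans (dev_small a)).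
by have := sqrtr_ge0 (n%:R * q a * T); lra.
Qed.

Let eps0 : 0 <= eps. Proof. exact: sqrtr_ge0. Qed.

(** If all estimates are within [eps], the argmax loses at most [2 eps]; otherwise the regret is at
    most 1, hence at most the number of failing arms. A union bound over the [2 M + 1] arms
    concludes. *)
Lemma second_phase_regret :
  play X (second_phase X gamma B h1) (fun h2 => simple_regret X Y (out h1 h2))
    <= 2 * eps + (2 * M).+1%:R * (2 * expR (- (T / 8))).
Proof.
pose bad h2 : R := \sum_a (bad_estimate a h2)%:R.
apply: (@le_trans _ _ (play X (second_phase X gamma B h1)
    (fun h2 => 2 * eps + bad h2))).
  apply: le_play => [a w|h2 h2l]; first exact: arm_law_ge0.
  have bad0 : 0 <= bad h2 by apply: sumr_ge0 => a _; exact: ler0n.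
  have [/existsP[a bada]|] := boolP [exists a, bad_estimate a h2].
    apply: (le_trans (simple_regret_le1 _ _ _ _ _ _ _ _)) => //.
    have : 1 <= bad h2.
      rewrite /bad (bigD1 a) //= bada lerDl.
      by apply: sumr_ge0 => b _; exact: ler0n.
    by have := eps0; lra.
  rewrite negb_exists => /forallP ok.
  have near a := mu_hat_near _ _ h2l (ok a).
  apply: (@le_trans _ _ (2 * eps)); last by rewrite lerDl.
  apply: simple_regret_le => [|b]; first by have := eps0; lra.
  have := outP h1 h2 b; have := near b; have := near (out h1 h2).
  by rewrite !ler_norml => /andP[? ?] /andP[? ?]; lra.
have sum1 := arm_law_sum1 R G M X range_X.
rewrite playD play_cst // lerD2l play_sum -card_arm mulr_natl -sumr_const.
by apply: ler_sum => a _; exact: bad_estimate_tail.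
Qed.

End FirstPhase.

(** The 6 gathers three two-sided tails per arm: counts and deviations in the first phase, and
    estimates in the second. When [good] fails, the regret 1 is paid by the number of first-phase
    failures. *)
Lemma expected_regret_le :
  expected_regret X Y gamma B out <=
  2 * eps + (2 * M).+1%:R * (6 * expR (- (T / 8))).
Proof.
have law0 := arm_law_ge0 R G M X.
have sum1 := arm_law_sum1 R G M X range_X.
pose c := 2 * eps + (2 * M).+1%:R * (2 * expR (- (T / 8))).
pose bad (h1 : history G M) : R :=
  \sum_a ((bad_count a h1)%:R + (bad_dev n a h1)%:R).
apply: (@le_trans _ _ (play X (nseq n None) (fun h1 => c + bad h1))).
  apply: le_play => [//|h1 h1n].
  have bad0 : 0 <= bad h1 by apply: sumr_ge0 => a _; rewrite addr_ge0 ?ler0n.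
  have [ok|] := boolP (good h1).
    by rewrite (le_trans (second_phase_regret _ h1n ok)) // lerDl.
  rewrite negb_forall => /existsP[a bada].
  have c0 : 0 <= c.
    by rewrite addr_ge0 ?mulr_ge0 ?sqrtr_ge0 ?expR_ge0.
  have : 1 <= bad h1.
    rewrite /bad (bigD1 a) //= -[leLHS]addr0 lerD //; last first.
      by apply: sumr_ge0 => b _; rewrite addr_ge0 ?ler0n.
    move: bada; rewrite negb_and !negbK.
    by case: bad_count => [_|/= ->]; rewrite ?lerDl ?lerDr ?ler0n.
  suff : play X (second_phase X gamma B h1)
      (fun h2 => simple_regret X Y (out h1 h2)) <= 1 by lra.
  rewrite -(play_cst R G M X sum1 (second_phase X gamma B h1) 1).
  by apply: le_play => // h2 _; exact: simple_regret_le1.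
rewrite playD play_cst // /c -addrA lerD2l play_sum -lerBrDl -mulrBr.
rewrite (_ : _ - _ = 4 * expR (- (T / 8))); last by ring.
rewrite -card_arm [leRHS]mulr_natl -sumr_const; apply: ler_sum => a _.
have := bad_count_tail a; have := bad_dev_tail n a (leqnn n).
by rewrite playD; lra.
Qed.

End Regret.

(** * Large budgets *)

(** Write [ln x = 2 ln (sqrt x) <= 2 sqrt x] and use [2 / c <= sqrt x]. *)
Lemma ln_le_linear {R : realType} (c x : R) : 0 < c -> (2 / c) ^+ 2 <= x ->
  ln x <= c * x.
Proof.
move=> c0 cx; have x0 : 0 < x by apply: lt_le_trans cx; rewrite exprn_gt0 ?divr_gt0.
have r0 : 0 < Num.sqrt x by rewrite sqrtr_gt0.
have xE : x = Num.sqrt x ^+ 2 by rewrite sqr_sqrtr // ltW.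
have cr : 2 / c <= Num.sqrt x.
  by rewrite -[leLHS]ger0_norm ?divr_ge0 ?(ltW c0) // -sqrtr_sqr ler_wsqrtr.
rewrite [in leLHS]xE lnXn // [in leRHS]xE.
have : ln (Num.sqrt x) <= Num.sqrt x.
  have := @le_ln1Dx R (Num.sqrt x - 1); rewrite subrKC => /(_ _)/le_trans.
  by apply; [rewrite ltrBrDl subrr | rewrite gerBl].
move: cr; rewrite ler_pdivrMr // mulr2n expr2 => cr lnr.
have : 2 * Num.sqrt x <= Num.sqrt x * c * Num.sqrt x by rewrite ler_wpM2r // ltW.
lra.
Qed.

Section Asymptotics.
Variables (R : realType) (G : causal_bn R) (M : nat).
Variables (X : 'I_M -> node G) (Y : node G) (gamma : R).
Hypothesis M2 : (2 <= M)%N.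
Hypothesis range_Y : range_size Y = 2%N.
Hypothesis range_X : forall i, range_size (X i) = 2%N.
Hypothesis nbd : forall i, no_backdoor (X i) Y.
Hypothesis gamma1 : 1 <= gamma.

Let p := min_prob (prob X).
Let m := m_of (fun i => prob X i true).
Hypothesis p0 : 0 < p.

(** The factor [c] stands for [p M] or [M / (gamma m)] in the displayed logarithms; a large budget
    absorbs it. *)
Lemma expected_regret_asymptotic (K c : R) :
  K = p^-1 \/ K = gamma * m%:R -> 0 < c ->
  exists B0 : nat, forall B : nat, (B0 <= B)%N ->
  forall out, output_rule X Y gamma out ->
  expected_regret X Y gamma B out <= 1000 * Num.sqrt (K / B%:R * ln (c * B%:R)).
Proof.
move=> KE c0.
have M0 : 0 < M%:R :> R by rewrite ltr0n (leq_trans _ M2).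
have gamma0 : 0 < gamma by exact: lt_le_trans gamma1.
have p1 : p <= 1 by exact: min_prob_le1.
have K1 : 1 <= K.
  case: KE => ->; first by rewrite invf_ge1.
  have [m2 _ _] := m_of_spec _ _ M2 (fun i => prob X i true).
  have m2R : 2 <= m%:R :> R by rewrite ler_nat.
  have : 1 * 2 <= gamma * m%:R by rewrite ler_pM.
  lra.
pose kappa := (p / (4 * M%:R)) ^+ 2 / (8 * gamma * M%:R).
have kappa0 : 0 < kappa by rewrite !(divr_gt0, exprn_gt0, mulr_gt0).
(* The summands ensure in turn [1 <= ln B], [ln B <= kappa / 48 * B], [B <= (c B) ^+ 2], a failure
   term of at most [1 / B], and [B >= 3], whence [B <= 3 n]. *)
pose b : R := expR 1 + (2 / (kappa / 48)) ^+ 2 + (c ^+ 2)^-1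
  + (2 * M).+1%:R * 6 + 2.
have e0 := expR_gt0 (1 : R).
have k0 : 0 <= (2 / (kappa / 48)) ^+ 2 by exact: sqr_ge0.
have ci0 : 0 <= (c ^+ 2)^-1 by rewrite invr_ge0 sqr_ge0.
have M60 : 0 <= (2 * M).+1%:R * 6 :> R by rewrite mulr_ge0.
exists (Num.truncn b).+1 => B B0B out outP.
have bB : b < B%:R by apply: lt_le_trans (truncnS_gt b) _; rewrite ler_nat.
rewrite /b in bB.
have B2 : 2 < B%:R :> R by lra.
have B0 : 0 < B%:R :> R by lra.
have B3 : B%:R <= 3 * (B./2)%:R :> R.
  rewrite -natrM ler_nat; have : (2 < B)%N by rewrite -(ltr_nat R).
  by clear; have := odd_double_half B; case: odd; lia.
have n0 : 0 < (B./2)%:R :> R by lra.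
set n := B./2 in B3 n0.
have lnB1 : 1 <= ln (B%:R : R).
  rewrite -[leLHS](@expRK R) ler_ln ?posrE ?expR_gt0 //; lra.
have lnBk : ln (B%:R : R) <= kappa / 48 * B%:R.
  by apply: ln_le_linear; [rewrite divr_gt0 | lra].
have lnBc : ln (B%:R : R) <= 2 * ln (c * B%:R).
  rewrite mulr_natl -lnXn ?mulr_gt0 // ler_ln ?posrE ?exprn_gt0 ?mulr_gt0 //.
  rewrite exprMn [B%:R ^+ 2]expr2 mulrA ler_peMl ?(ltW B0) //.
  rewrite mulrC -ler_pdivrMr ?exprn_gt0 // mul1r; lra.
(* With 16, the tail [expR (- (T / 8))] is [1 / B ^+ 2]; the 48 above is [16 * 3], so that
   [T <= kappa * n]. *)
pose T : R := 16 * ln B%:R.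
have T1 : 1 <= T by rewrite /T; lra.
have Tn : T <= kappa * n%:R.
  have : kappa * B%:R <= kappa * (3 * n%:R) by rewrite ler_pM2l.
  by rewrite /T; move: lnBk; lra.
apply: (le_trans (expected_regret_le R G M X Y gamma M2 range_Y range_X nbd gamma1
  p0 B out outP T K T1 Tn KE)).
rewrite -/n; set eps := Num.sqrt _.
have KT1 : 1 <= K * T by rewrite -[leLHS]mulr1 ler_pM.
(* The failure term is at most [1 / B <= sqrt (1 / n)], and [eps] is at least this since
   [1 <= K * T]. *)
have fail : (2 * M).+1%:R * (6 * expR (- (T / 8))) <= eps.
  have -> : expR (- (T / 8)) = (B%:R ^+ 2)^-1.
    rewrite -[in RHS](lnK (_ : B%:R \is Num.pos)) ?posrE // -expRM_natl -expRN.
    by congr expR; rewrite /T; lra.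
  apply: (@le_trans _ _ (B%:R^-1)).
    rewrite mulrA ler_pdivrMr ?exprn_gt0 // expr2 mulrA mulVf ?mul1r ?gt_eqF //.
    lra.
  rewrite -[leLHS]ger0_norm ?invr_ge0 ?(ltW B0) // -sqrtr_sqr ler_wsqrtr //.
  apply: (@le_trans _ _ B%:R^-1).
    rewrite expr2 ler_piMl ?invr_ge0 ?(ltW B0) // invf_le1 //; lra.
  apply: (@le_trans _ _ n%:R^-1).
    by rewrite lef_pV2 ?posrE // ler_nat /n -divn2 leq_div.
  by rewrite ler_peMl ?invr_ge0 ?(ltW n0) //; lra.
apply: (@le_trans _ _ (3 * eps)); first by lra.
(* After squaring, the constant is [9 * 1152 * 16 * 2 * 3 = 995328], below [1000 ^+ 2]; the 2 comes
   from [lnBc] and the last 3 from [B <= 3 n]. *)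
rewrite -[3](@ger0_norm R) // -[1000](@ger0_norm R) // -!sqrtr_sqr /eps.
rewrite -!sqrtrM ?sqr_ge0 // ler_wsqrtr // mulrA ler_pdivrMr //.
have : K * ln B%:R <= K * (2 * ln (c * B%:R)) by rewrite ler_wpM2l //; lra.
set L := ln (c * _); set L0 := ln _ => KL.
have KL0 : 0 <= K * L.
  suff : 0 <= K * L0 by lra.
  by rewrite mulr_ge0 //; rewrite /L0; lra.
have nB : 3^-1 <= n%:R / B%:R :> R by rewrite ler_pdivlMr //; lra.
apply: (@le_trans _ _ (1000 ^+ 2 * (K * L) * 3^-1)).
  by rewrite /T -/L0; lra.
rewrite (_ : _ * n%:R = 1000 ^+ 2 * (K * L) * (n%:R / B%:R)); last by ring.
by rewrite ler_wpM2l // mulr_ge0 // exprn_ge0.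
Qed.

End Asymptotics.

Theorem theorem2 (R : realType) :
  exists2 C : R, 0 < C &
  forall (G : causal_bn R) (M : nat) (X : 'I_M -> node G) (Y : node G)
         (gamma : R),
    (2 <= M)%N ->
    injective X ->
    (forall i, X i != Y) ->
    range_size Y = 2%N ->
    (forall i, range_size (X i) = 2%N) ->
    (forall i, no_backdoor (X i) Y) ->
    1 <= gamma ->
    let p := min_prob (prob X) in
    let m : R := (m_of (fun i => prob X i true))%:R in
    0 < p ->
    ((p * m)^-1 <= gamma ->
       exists B0 : nat, forall B : nat, (B0 <= B)%N ->
       forall out, output_rule X Y gamma out ->
       expected_regret X Y gamma B out
         <= C * Num.sqrt (1 / (p * B%:R) * ln (p * M%:R * B%:R)))
    /\
    (gamma <= (p * m)^-1 ->
       exists B0 : nat, forall B : nat, (B0 <= B)%N ->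
       forall out, output_rule X Y gamma out ->
       expected_regret X Y gamma B out
         <= C * Num.sqrt (gamma * m / B%:R * ln (M%:R * B%:R / (gamma * m)))).
Proof.
exists 1000 => // G M X Y gamma M2 _ _ rY rX nbd gamma1 p m p0.
have M0 : 0 < M%:R :> R by rewrite ltr0n (leq_trans _ M2).
have bound := expected_regret_asymptotic R G M X Y gamma M2 rY rX nbd gamma1 p0.
split=> _.
  have [B0 B0P] := bound _ _ (or_introl (erefl _)) (mulr_gt0 p0 M0).
  exists B0 => B BB0 out outP; rewrite mul1r invfM.
  exact: B0P.
have m0 : 0 < m.
  by rewrite ltr0n; have [m2 _ _] := m_of_spec _ _ M2 (fun i => prob X i true);
     apply: leq_trans m2.
have gm0 : 0 < gamma * m by rewrite mulr_gt0 // (lt_le_trans _ gamma1).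
have [B0 B0P] := bound _ _ (or_intror (erefl _)) (divr_gt0 M0 gm0).
exists B0 => B BB0 out outP; rewrite [M%:R * B%:R / _]mulrAC.
exact: B0P.
Qed.
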